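(* Any ISN game $(N,v)$ can be represented as a basic MC-Net; that is, there exists a basic MC-Net over $N$ such that for every $S\subseteq N$, $v(S)$ equals the sum of the values of all rules of the MC-Net that are applicable to $S$.
   Context: A cooperative game (with transferable utility) is a pair $(N,v)$ where $N$ is a finite set of agents and $v:2^N\to\mathbb{R}$. It is superadditive if $v(S\cup T)\ge v(S)+v(T)$ for all disjoint $S,T\subseteq N$. ISN game: let $N$ be a non-empty finite set of industrial agents and, for every $S\subseteq N$, let $T(S)$ and $O(S)$ be real numbers (total traditional cost and total operational cost of $S$). The Industrial Symbiotic Network (ISN) among agents in $N$ is a normalized superadditive cooperative game $(N,v)$ with $v(S)=0$ if $|S|\le 1$ and $v(S)=T(S)-O(S)$ otherwise. (Normalized means that the empty and singleton groups have value $0$.) A basic MC-Net (Marginal Contribution Net) over $N$ is a finite set of rules $\{\rho_i:(\mathcal{P}_i,\mathcal{N}_i)\mapsto v_i\}_{i\in K}$ with $\mathcal{P}_i\subseteq N$, $\mathcal{N}_i\subset N$, $\mathcal{P}_i\cap\mathcal{N}_i=\emptyset$, $v_i\in\mathbb{R}\setminus\{0\}$, and $K$ the set of rule indices. Rule $\rho_i$ is applicable to $S\subseteq N$ if $\mathcal{P}_i\subseteq S$ and $\mathcal{N}_i\cap S=\emptyset$. With $\Pi(S)$ the set of indices of rules applicable to $S$, the MC-Net assigns to $S$ the value $\sum_{i\in\Pi(S)}v_i$. *)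

(* Defs.v *)
From HB Require Import structures.
From mathcomp Require Import all_boot all_order all_algebra.
From mathcomp Require Import reals.

Set Implicit Arguments.
Unset Strict Implicit.
Unset Printing Implicit Defensive.

Import Order.TTheory GRing.Theory Num.Theory.
Local Open Scope ring_scope.

(* The set of agents is a finite type N, coalitions are {set N}, and a
   cooperative game is its characteristic function v : {set N} -> R. *)
Definition superadditive (R : realType) (N : finType) (v : {set N} -> R) : Prop :=
  forall A B : {set N}, [disjoint A & B] -> v A + v B <= v (A :|: B).

(* tcost and ocost give the total traditional and total operational cost of
   each coalition. *)
Record ISN_game (R : realType) (N : finType)
    (tcost ocost v : {set N} -> R) : Prop := ISNGame {
  ISN_nonempty : (0 < #|N|)%N;
  ISN_valueE : forall S : {set N},
    v S = if (#|S| <= 1)%N then 0 else tcost S - ocost S;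
  ISN_superadditive : superadditive v }.

Record mc_rule (R : realType) (N : finType) : Type := MCRule {
  rule_pos : {set N};
  rule_neg : {set N};
  rule_value : R;
  rule_neg_proper : rule_neg \proper [set: N];
  rule_disjoint : [disjoint rule_pos & rule_neg];
  rule_value_neq0 : rule_value != 0 }.

(* The rules form a set, so the indexing is injective: no rule is counted
   twice. Several rules may still share the same pattern with different
   values. *)
Record mc_net (R : realType) (N : finType) : Type := MCNet {
  mc_index : finType;
  mc_rules : mc_index -> mc_rule R N;
  mc_rules_inj : injective mc_rules }.

Definition applicable (R : realType) (N : finType)
    (rho : mc_rule R N) (S : {set N}) : bool :=
  (rule_pos rho \subset S) && (rule_neg rho :&: S == set0).

Definition applicable_indices (R : realType) (N : finType)
    (M : mc_net R N) (S : {set N}) : {set mc_index M} :=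
  [set i | applicable (mc_rules i) S].

Definition mc_value (R : realType) (N : finType)
    (M : mc_net R N) (S : {set N}) : R :=
  \sum_(i in applicable_indices M S) rule_value (mc_rules i).

(* Main.v *)
(* Give each coalition C with v C <> 0 its own rule (C, N \ C) |-> v C: it
   applies to C and to no other coalition.  Normalization excludes C = set0, so
   the negative pattern N \ C is always proper. *)
Require Import Defs.
From HB Require Import structures.
From mathcomp Require Import all_boot all_order all_algebra.
From mathcomp Require Import reals.

Section ExactRules.
Variables (R : realType) (N : finType) (v : {set N} -> R).
Hypothesis v0 : v set0 = 0%R.

(** Indexing by a subtype makes each index carry the proof that its rule value is nonzero. *)
Let supp := {C : {set N} | v C != 0%R}.

Lemma setC_supp_proper (C : supp) : ~: val C \proper [set: N].
Proof.
rewrite properT -setC0 (inj_eq (@setC_inj N)).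
by apply: contraNneq (valP C) => ->; rewrite v0.
Qed.

Lemma disjoint_setC (C : {set N}) : [disjoint C & ~: C].
Proof. by rewrite -setI_eq0 setICr. Qed.

Definition exact_rule (C : supp) : mc_rule R N :=
  @MCRule R N (val C) (~: val C) (v (val C))
    (setC_supp_proper C) (disjoint_setC (val C)) (valP C).

Lemma exact_rule_inj : injective exact_rule.
Proof. by move=> C D /(congr1 (@rule_pos R N))/val_inj. Qed.

Definition exact_net : mc_net R N := @MCNet R N supp exact_rule exact_rule_inj.

(** The positive pattern forces [val C] to lie inside [S]; avoiding its complement forces the
    reverse inclusion. *)
Lemma applicable_exact_rule (C : supp) (S : {set N}) :
  applicable (exact_rule C) S = (val C == S).
Proof.
by rewrite /applicable /= setIC -setDE setD_eq0 eqEsubset.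
Qed.

Lemma exact_net_value (S : {set N}) : mc_value exact_net S = v S.
Proof.
rewrite /mc_value.
under eq_bigl => C do rewrite inE applicable_exact_rule.
(* If [v S] is zero, any term left in the sum would equal [v S], so the sum vanishes; otherwise [S]
   itself gives the only index. *)
have [vS0|vSn0] := eqVneq (v S) 0%R.
  by rewrite big1 => [|C /eqP CS]; rewrite ?vS0 //= CS.
by rewrite (big_pred1 (exist _ S vSn0 : supp)).
Qed.

End ExactRules.

Theorem proposition1 (R : realType) (N : finType)
    (tcost ocost v : {set N} -> R) (hv : ISN_game tcost ocost v) :
  exists M : mc_net R N, forall S : {set N}, v S = mc_value M S.
Proof.
have v0 : v set0 = 0%R by rewrite (ISN_valueE hv) cards0.
by exists (exact_net R N v v0) => S; rewrite exact_net_value.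
Qed.
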